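(* Let $\Lambda,\Omega>0$ with $\Lambda\Omega<1/2$, and let $\mu=\sum_{j=1}^s c_j\delta_{t_j}$ be a complex measure having support $\{t_1,t_2,\dots,t_s\}\subset[0,\Lambda]$. Let $d\ge3$, and let $n$ be a prime with $$n>\frac{6d\,(1+6/\ln(s/(\Lambda\Omega)))\,s}{d-2\sqrt{d-1}}.$$ Let $V=\{v_0,v_1,v_2,\dots,v_n\}$ with $v_k=hk$ and $h=2\Lambda/n$, and let $\Gamma$ be a Ramanujan graph of degree $d$ having the vertex set $V$. Then phase propagation applied to the oversampled measurement $\{\mathcal M_{i,\Gamma}(\tilde\mu)\}_{i=0}^2$ provides the values $\zeta\hat\mu(2k\Omega/(n+1))$ for each $k\in\{1,2,\dots,(n+1)/2\}$, with a remaining residual unknown $\zeta\in\mathbb C$, $|\zeta|=1$. Moreover, the unique monic polynomial $q(z)=\sum_{l=0}^s q_lz^l$ of degree $s$ satisfying the homogeneous system of equations for $k\in\{1,2,\dots,s+1\}$ $$\sum_{l=0}^s q_l\,\hat\mu\bigl(2(k+l)\Omega/(n-1)\bigr)=0$$ factors into $q(z)=\prod_{j=1}^s(z-z_j)$ with $z_j=e^{-2\pi i t_j\Omega/n}$, and the system $$\sum_{j=1}^s c_jz_j^k=c\,\hat\mu(v_k),\qquad k\in\{1,2,\dots,n\},$$ in which the scalar factor $c$ on the right-hand side is a residual unimodular constant, has a unique solution, the coefficient vector $(c_1,\dots,c_s)\in\mathbb C^s$.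
   Context: The Fourier transform of $\mu=\sum_{j=1}^s c_j\delta_{t_j}$ ($\delta_t$ the Dirac measure at $t$) is $\hat\mu(\omega)=\sum_{j=1}^s c_je^{-2\pi i\omega t_j}$, $\omega\in\mathbb R$. The function $\tilde\mu$ is defined by $\tilde\mu(t)=\sum_{k=1}^{m}\hat\mu(k\Omega/m)\,e^{i\pi tk/\Lambda}$ with $m=(n+1)/2$. For a finite graph $\Gamma=(V,E)$ whose vertices are distinct real numbers $v_j$ and a function $g:\mathbb R\to\mathbb C$, define $\mathcal M_{0,\Gamma}(g)=(|g(v_j)|^2)_j$, $\mathcal M_{1,\Gamma}(g)=(|g(v_j)-g(v_k)|^2)_{\{v_j,v_k\}\in E,\,j<k}$, $\mathcal M_{2,\Gamma}(g)=(|g(v_j)-i\,g(v_k)|^2)_{\{v_j,v_k\}\in E,\,j<k}$. Phase propagation: if $\{v,w\}\in E$ and $g(v)\ne0$, the quotient $g(w)/g(v)$ can be computed from the measurements attached to $v$, $w$ and the edge $\{v,w\}$. Fixing the phase of $g$ at one vertex of a connected component of the subgraph of $\Gamma$ induced by $\{v\in V: g(v)\ne0\}$ therefore determines, by successive assignment along edges, the values of $g$ on that component up to one common unimodular factor. The values of $\hat\mu$ are then obtained from those of $\tilde\mu$ on such a component by inverting the linear map that takes the samples of $\hat\mu$ to those of $\tilde\mu$. The normalized Laplace operator of a $d$-regular finite graph $\Gamma=(V,E)$ is $L_\Gamma\varphi(v)=\varphi(v)-\frac1d\sum_{\{v,w\}\in E}\varphi(w)$ on $\ell^2(V)$, and $\lambda_1(L_\Gamma)$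 is its smallest nonzero eigenvalue. For an integer $d\ge3$, a $d$-regular connected finite graph $\Gamma$ is called a Ramanujan graph if $\lambda_1(L_\Gamma)\ge 1-\frac{2\sqrt{d-1}}{d}$.
   Formalization: As printed the second half fails (e.g. s=1, t_1>0: steps disagree). Here one step τ, any of 2Ω/(n+1), 2Ω/(n-1), Ω/n, is used in the q-system, in z_j=e^{-2πi t_j τ} and in the last system (μ̂(kτ) for μ̂(v_k)), whose solution is c·(c_1,…,c_s). *)

(* Defs.v *)
From mathcomp Require Import all_boot all_order all_algebra.
From mathcomp Require Import complex.
From mathcomp Require Import reals exp trigo.

Set Implicit Arguments.
Unset Strict Implicit.
Unset Printing Implicit Defensive.

Import Order.TTheory GRing.Theory Num.Theory.
Import ComplexField.Normc.

Local Open Scope ring_scope.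
Local Open Scope complex_scope.

Definition expi (R : realType) (x : R) : R[i] := cos x +i* sin x.

(* The Fourier transform of the measure \sum_j c_j \delta_{t_j}. *)
Definition fourier (R : realType) (s : nat) (c : 'I_s -> R[i]) (t : 'I_s -> R)
    (omega : R) : R[i] :=
  \sum_(j < s) c j * expi (- (2 * pi * omega * t j)).

(* The linear map from a vector of m samples to a function on the line.  Rows
   are indexed from 0, so that [x 0 k] is the sample of index k + 1. *)
Definition oversample (R : realType) (Lambda : R) (m : nat) (x : 'rV[R[i]]_m)
    (u : R) : R[i] :=
  \sum_(k < m) x 0 k * expi (pi * u * k.+1%:R / Lambda).

Definition mutilde (R : realType) (Lambda Omega : R) (m s : nat)
    (c : 'I_s -> R[i]) (t : 'I_s -> R) : R -> R[i] :=
  oversample Lambda (\row_(k < m) fourier c t (k.+1%:R * Omega / m%:R)).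

Definition simple_graph (T : finType) (e : rel T) : Prop :=
  symmetric e /\ irreflexive e.

Definition connected_graph (T : finType) (e : rel T) : Prop :=
  forall v w : T, connect e v w.

Definition regular_graph (T : finType) (e : rel T) (d : nat) : Prop :=
  forall v : T, #|[set w | e v w]| = d.

(* This matrix is symmetric, hence it does not matter that [eigenvalue] refers
   to row vectors. *)
Definition laplacian (R : realType) (N : nat) (e : rel 'I_N) (d : nat)
    : 'M[R]_N :=
  \matrix_(v, w) ((v == w)%:R - (e v w)%:R / d%:R).

Definition smallest_nonzero_eigenvalue (R : realType) (N : nat) (A : 'M[R]_N)
    (a : R) : Prop :=
  [/\ eigenvalue A a, a != 0
    & forall b : R, eigenvalue A b -> b != 0 -> a <= b].

Definition ramanujan (R : realType) (N : nat) (e : rel 'I_N) (d : nat) : Prop :=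
  [/\ simple_graph e, connected_graph e, regular_graph e d
    & exists2 lambda1 : R,
        smallest_nonzero_eigenvalue (laplacian R e d) lambda1
        & 1 - 2 * Num.sqrt (d%:R - 1) / d%:R <= lambda1].

(* [M1 M j k] and [M2 M j k] are attached to the edge {v_j, v_k} with j < k. *)
Record measurement (R : realType) (N : nat) := Measurement {
  M0 : 'I_N -> R;
  M1 : 'I_N -> 'I_N -> R;
  M2 : 'I_N -> 'I_N -> R
}.

(* The default value 0 is used at the pairs (j, k) that do not index an edge,
   so that no measurement is available there. *)
Definition measure_graph (R : realType) (N : nat) (v : 'I_N -> R)
    (e : rel 'I_N) (g : R -> R[i]) : measurement R N :=
  {| M0 := fun j => normc (g (v j)) ^+ 2;
     M1 := fun j k =>
       if (j < k)%N && e j k then normc (g (v j) - g (v k)) ^+ 2 else 0;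
     M2 := fun j k =>
       if (j < k)%N && e j k then normc (g (v j) - 'i * g (v k)) ^+ 2 else 0 |}.

(* For an edge with j < k, polarization gives
     |g_j - g_k|^2   = |g_j|^2 + |g_k|^2 - 2 Re (g_j conj(g_k)),
     |g_j - i g_k|^2 = |g_j|^2 + |g_k|^2 - 2 Im (g_j conj(g_k)),
   so that [cross M j k] is g_j conj(g_k). *)
Definition cross (R : realType) (N : nat) (M : measurement R N) (j k : 'I_N)
    : R[i] :=
  ((M0 M j + M0 M k - M1 M j k) / 2) +i* ((M0 M j + M0 M k - M2 M j k) / 2).

(* The quotient g_w / g_v = g_w conj(g_v) / |g_v|^2 along the edge {v, w}. *)
Definition quotient (R : realType) (N : nat) (M : measurement R N)
    (v w : 'I_N) : R[i] :=
  (if (v < w)%N then (cross M v w)^* else cross M w v) / (M0 M v)%:C.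

(* [propagated M e r a f] means that the partial assignment [f] of values to
   vertices is reached by giving the value [a], of the measured modulus, to the
   vertex [r] and then assigning values successively along edges of the subgraph
   induced by the vertices at which the measured modulus does not vanish. *)
Inductive propagated (R : realType) (N : nat) (M : measurement R N)
    (e : rel 'I_N) (r : 'I_N) (a : R[i]) : ('I_N -> option R[i]) -> Prop :=
| propagated_root :
    M0 M r != 0 -> normc a ^+ 2 = M0 M r ->
    propagated M e r a (fun u => if u == r then Some a else None)
| propagated_step (f : 'I_N -> option R[i]) (v w : 'I_N) (z : R[i]) :
    propagated M e r a f -> f v = Some z -> f w = None ->
    e v w -> M0 M w != 0 ->
    propagated M e r a
      (fun u => if u == w then Some (z * quotient M v w) else f u).

Definition exhausted (R : realType) (N : nat) (M : measurement R N)
    (e : rel 'I_N) (f : 'I_N -> option R[i]) : Prop :=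
  forall v w : 'I_N, f v -> e v w -> M0 M w != 0 -> f w.

(* [x] is an output of phase propagation: a propagation is run until the
   connected component of its root is exhausted, this component is such that the
   map sending m samples to the values of [oversample] on it is injective, and
   [x] is obtained by inverting this map. *)
Definition phase_propagation (R : realType) (N : nat) (Lambda : R)
    (v : 'I_N -> R) (e : rel 'I_N) (M : measurement R N) (m : nat)
    (x : 'rV[R[i]]_m) : Prop :=
  exists (r : 'I_N) (a : R[i]) (f : 'I_N -> option R[i]),
    [/\ propagated M e r a f,
        exhausted M e f,
        forall y y' : 'rV[R[i]]_m,
          (forall u, f u -> oversample Lambda y (v u)
                            = oversample Lambda y' (v u)) -> y = y'
      & forall (u : 'I_N) (z : R[i]),
          f u = Some z -> oversample Lambda x (v u) = z].

(* Main.v *)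
(* At v_l = 2 Lambda l / n the oversampled function g is the value of an
   exponential sum at z_l = e^(2 pi i l / n).  As n = 2m - 1, the point y_l = z_l^m
   satisfies y_l^2 = z_l and z_l^m = y_l, so that summing the geometric series in g
   and clearing denominators leaves a nonzero polynomial in y_l of degree less than
   2s: at most 2s of the n + 1 vertices are zeros of g.  If every component of the
   graph without these zeros had at most (n + 1)/2 vertices, then the Poincare
   inequality for the indicator of each component, with the number of edges at the
   zeros as an upper bound, would force n (1 - 2 sqrt(d - 1)/d) <= 6 s.  Hence some
   component has more than m vertices; they carry at least m distinct nodes z_l, and
   the oversampling map is injective on it.  The rest is Prony's method. *)
Require Import Defs.
From mathcomp Require Import all_boot all_order all_algebra.
From mathcomp Require Import complex.
From mathcomp Require Import reals exp trigo.
From mathcomp Require Import ring lra zify.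

Set Implicit Arguments.
Unset Strict Implicit.
Unset Printing Implicit Defensive.

Import Order.TTheory GRing.Theory Num.Theory.

Local Open Scope ring_scope.
Local Open Scope complex_scope.

(** * Vandermonde systems with exponents starting at 1 *)

(** The relations are combined with the coefficients of [p], the polynomial of degree s - 1
    vanishing at every node except z_j. Only a_j z_j p(z_j) survives, and neither z_j nor p(z_j) is
    0. *)
Lemma vandermonde_kernel (F : fieldType) (s : nat) (z a : 'I_s -> F) :
  injective z -> (forall j, z j != 0) ->
  (forall k : nat, (1 <= k <= s)%N -> \sum_(j < s) a j * z j ^+ k = 0) ->
  forall j, a j = 0.
Proof.
move=> z_inj z_neq0 a0 j.
pose p : {poly F} := \prod_(i in predC1 j) ('X - (z i)%:P).
have sp : size p = s.
  rewrite /p -big_enum size_prod_XsubC -cardE cardC1 card_ord prednK //.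
  exact: leq_ltn_trans (ltn_ord j).
have : \sum_(i < s) a i * (z i * p.[z i]) = 0.
  under eq_bigr do rewrite horner_coef sp !mulr_sumr.
  rewrite exchange_big big1 //= => k _.
  transitivity (p`_k * \sum_i a i * z i ^+ k.+1).
    by rewrite mulr_sumr; apply: eq_bigr => i _; rewrite exprS; ring.
  by rewrite a0 ?mulr0 // ltn_ord.
have p0 i : i != j -> p.[z i] = 0.
  by move=> ij; rewrite /p (bigD1 i) //= !hornerE subrr mul0r.
rewrite (bigD1 j) //= big1 => [|i ij]; last by rewrite p0 // !mulr0.
move/eqP; rewrite addr0 !mulf_eq0 (negPf (z_neq0 j)) /= => /orP[/eqP//|].
rewrite /p horner_prod => /prodf_eq0[i ij].
by rewrite !hornerE subr_eq0 => /eqP/z_inj/eqP; rewrite eq_sym (negPf ij).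
Qed.

(** * A Rayleigh quotient bound for real symmetric matrices *)

Section SymmetricMatrices.
Local Open Scope sesquilinear_scope.

(** A unitary eigenbasis of the complexified matrix turns both sides into weighted sums of |y_i|^2.
    Terms with eigenvalue 0 vanish because [f] is orthogonal to the kernel; in the others the
    eigenvalue is at least [lam]. *)
Lemma symmetric_min_eigenvalue (R : rcfType) (N : nat) (A : 'M[R]_N)
    (lam : R) (f : 'rV[R]_N) :
  A^T = A ->
  (forall b, eigenvalue A b -> b != 0 -> lam <= b) ->
  (forall u : 'rV[R]_N, u *m A = 0 -> u *m f^T = 0) ->
  lam * (f *m f^T) 0 0 <= (f *m A *m f^T) 0 0.
Proof.
move=> A_sym lamP ker_f.
pose toC := map_mx (real_complex R).
have toCM m n p (B : 'M[R]_(m, n)) (B' : 'M_(n, p)) :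
    toC _ _ (B *m B') = toC _ _ B *m toC _ _ B'.
  exact: map_mxM.
have toC_realP m n (B : 'M[R]_(m, n)) : toC _ _ B \is a mxOver Num.real.
  by apply/mxOverP=> i j; rewrite mxE; apply/complex_realP; exists (B i j).
set AC := toC _ _ A.
have herm : AC \is hermsymmx.
  apply: realsym_hermsym; last exact: toC_realP.
  apply/is_hermitianmxP; rewrite expr0 scale1r map_mx_id //.
  by rewrite /AC -{1}A_sym /toC map_trmx.
set P := spectralmx AC; set D := spectral_diag AC.
have Dreal i : exists b : R, D 0 i = b%:C.
  apply/complex_realP; move: (hermitian_spectral_diag_real herm).
  by move=> /mxOverP; apply.
have Punit : P \is unitarymx := spectral_unitarymx AC.
have PPt : P *m P^t* = 1%:M by apply/unitarymxP.
have ACE : AC = P^t* *m diag_mx D *m P.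
  rewrite -invmx_unitary ?spectral_unitarymx //.
  exact: (orthomx_spectralP (hermitian_normalmx herm)).
have eigP i : row i P *m AC = D 0 i *: row i P.
  rewrite ACE -row_mul !mulmxA PPt mul1mx row_mul.
  by rewrite row_diag_mx -scalemxAl -rowE.
pose y i := (row i P *m toC _ _ f^T) 0 0.
have fP : toC _ _ f *m P^t* = \row_i Num.conj (y i).
  apply/rowP=> i; rewrite /y !mxE rmorph_sum; apply: eq_bigr => k _.
  rewrite !mxE rmorphM mulrC; congr (_ * _).
  by apply/esym/CrealP/complex_realP; exists (f 0 k).
have Pf : P *m toC _ _ f^T = \col_i y i.
  by apply/colP=> i; rewrite /y !mxE; apply: eq_bigr => k _; rewrite !mxE.
have ff : ((f *m f^T) 0 0)%:C = \sum_i `|y i| ^+ 2.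
  transitivity ((toC _ _ f *m toC _ _ f^T) 0 0); first by rewrite -toCM [RHS]mxE.
  rewrite -(mulmxKtV (toC _ _ f) Punit) // fP -mulmxA Pf mxE.
  by apply: eq_bigr => i _; rewrite !mxE normCK mulrC.
have fAf : ((f *m A *m f^T) 0 0)%:C = \sum_i D 0 i * `|y i| ^+ 2.
  transitivity ((toC _ _ f *m AC *m toC _ _ f^T) 0 0).
    by rewrite -!toCM [RHS]mxE.
  rewrite ACE !mulmxA fP -mulmxA Pf mxE.
  by apply: eq_bigr => i _; rewrite mul_mx_diag !mxE normCK; ring.
(* The eigenvector is complex while [ker_f] speaks of real vectors. Its real and imaginary parts are
   both killed by the real matrix [A], so each is orthogonal to [f]. *)
have ker0 i : D 0 i = 0 -> y i = 0.
  move=> Di0; have uA : row i P *m AC = 0 by rewrite eigP Di0 scale0r.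
  pose a : 'rV[R]_N := \row_k complex.Re (P i k).
  pose b : 'rV[R]_N := \row_k complex.Im (P i k).
  have uab : row i P = toC _ _ a + 'i *: toC _ _ b.
    by apply/rowP=> k; rewrite !mxE [LHS]complexE.
  have split_mul n (B : 'M[R]_(N, n)) k :
      (row i P *m toC _ _ B) 0 k = (a *m B) 0 k +i* (b *m B) 0 k.
    rewrite uab mulmxDl -scalemxAl -!toCM !mxE.
    by rewrite [RHS]complexE.
  have [aA bA] : a *m A = 0 /\ b *m A = 0.
    by split; apply/rowP=> k; move/rowP/(_ k): uA; rewrite /AC split_mul !mxE => -[].
  by rewrite /y split_mul !ker_f // !mxE.
rewrite -subr_ge0 -ler0c.
have -> : ((f *m A *m f^T) 0 0 - lam * (f *m f^T) 0 0)%:C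
    = ((f *m A *m f^T) 0 0)%:C - lam%:C * ((f *m f^T) 0 0)%:C.
  by rewrite rmorphB rmorphM.
rewrite ff fAf mulr_sumr -sumrB sumr_ge0 // => i _.
rewrite -mulrBl; have [b Db] := Dreal i.
have [b0|b_neq0] := eqVneq b 0; first by rewrite ker0 ?normr0 ?expr0n ?mulr0 // Db b0.
rewrite mulr_ge0 ?exprn_ge0 //.
have lam_b : lam <= b.
  apply: lamP => //; rewrite -(eigenvalue_map (real_complex R)).
  apply/eigenvalueP; exists (row i P); first by have := eigP i; rewrite Db.
  apply/eqP => Pi0; have /row_unitarymxP/(_ i i) := Punit.
  by rewrite Pi0 dotmxE eqxx mul0mx mxE => /eqP; rewrite eq_sym oner_eq0.
by rewrite Db; move: lam_b; rewrite -lecR -subr_ge0.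
Qed.
End SymmetricMatrices.

(** * The Laplace operator: Dirichlet form, kernel and edge cuts *)

Lemma sum_degree (R : realType) (N d : nat) (e : rel 'I_N) (v : 'I_N) :
  regular_graph e d -> \sum_w (e v w)%:R = d%:R :> R.
Proof.
move=> e_reg; rewrite -(e_reg v) -sum1_card natr_sum [RHS]big_mkcond.
by apply: eq_bigr => w _; rewrite inE; case: (e v w).
Qed.

(** The double sum runs over ordered pairs and so counts each edge twice, whence the 2 in the
    denominator. *)
Lemma dirichlet_form (R : realType) (N d : nat) (e : rel 'I_N) (f : 'rV[R]_N) :
  simple_graph e -> regular_graph e d -> (0 < d)%N ->
  (f *m laplacian R e d *m f^T) 0 0
    = (\sum_v \sum_w (e v w)%:R * (f 0 v - f 0 w) ^+ 2) / (2 * d%:R).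
Proof.
move=> [e_sym _] e_reg d_gt0; have d_neq0 : d%:R != 0 :> R by rewrite pnatr_eq0 -lt0n.
have -> : \sum_v \sum_w (e v w)%:R * (f 0 v - f 0 w) ^+ 2
    = 2 * d%:R * \sum_v f 0 v ^+ 2
      - 2 * \sum_v \sum_w (e v w)%:R * (f 0 v * f 0 w).
  transitivity (\sum_v \sum_w (e v w)%:R * f 0 v ^+ 2
      + \sum_v \sum_w (e v w)%:R * f 0 w ^+ 2
      - 2 * \sum_v \sum_w (e v w)%:R * (f 0 v * f 0 w)).
    rewrite mulr_sumr -big_split -sumrB; apply: eq_bigr => v _ /=.
    rewrite mulr_sumr -big_split -sumrB; apply: eq_bigr => w _ /=; ring.
  congr (_ - _); rewrite [X in _ + X]exchange_big /=.
  have degE (g : 'I_N -> R) : \sum_v \sum_w (e v w)%:R * g v = d%:R * \sum_v g v.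
    rewrite mulr_sumr; apply: eq_bigr => v _.
    by rewrite -mulr_suml (sum_degree _ _ e_reg).
  rewrite degE; under [X in _ + X]eq_bigr do under eq_bigr do rewrite e_sym.
  by rewrite degE; ring.
transitivity (\sum_v f 0 v ^+ 2
    - (\sum_v \sum_w (e v w)%:R * (f 0 v * f 0 w)) / d%:R); last by field.
rewrite mxE mulr_suml -sumrB; apply: eq_bigr => w _.
rewrite !mxE mulr_suml.
rewrite (eq_bigr (fun v => (v == w)%:R * (f 0 v * f 0 w)
    - ((e w v)%:R * (f 0 w * f 0 v)) / d%:R)).
  rewrite sumrB -mulr_suml; congr (_ - _).
  by rewrite (bigD1 w) //= eqxx big1 ?addr0 ?mul1r ?expr2 // => v /negPf->; rewrite mul0r.
by move=> v _; rewrite !mxE e_sym; field.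
Qed.

(** The Dirichlet form of [u] vanishes, so [u] agrees at the two ends of every edge, and hence along
    paths. *)
Lemma laplacian_kernel (R : realType) (N d : nat) (e : rel 'I_N) (u : 'rV[R]_N) :
  simple_graph e -> connected_graph e -> regular_graph e d -> (0 < d)%N ->
  u *m laplacian R e d = 0 -> forall v w, u 0 v = u 0 w.
Proof.
move=> e_simple e_conn e_reg d_gt0 uL.
have := dirichlet_form u e_simple e_reg d_gt0; rewrite uL mul0mx mxE => /esym/eqP.
rewrite mulf_eq0 invr_eq0 mulf_eq0 !pnatr_eq0 (gtn_eqF d_gt0) !orbF.
rewrite psumr_eq0 => [/allP sum0|v _]; last first.
  by apply: sumr_ge0 => w _; rewrite mulr_ge0 ?ler0n ?sqr_ge0.
have edge v w : e v w -> u 0 v = u 0 w.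
  move=> evw; have := sum0 v (mem_index_enum _); rewrite psumr_eq0 => [|w' _]; last first.
    by rewrite mulr_ge0 ?ler0n ?sqr_ge0.
  move=> /allP/(_ w (mem_index_enum _)); rewrite evw mul1r sqrf_eq0 subr_eq0.
  by move/eqP.
move=> v w; have /connectP[p + ->] := e_conn v w.
by elim: p v => //= x p IHp v /andP[/edge -> /IHp].
Qed.

(** This is the Poincare inequality for the centred indicator of [S]: its squared norm is |S| -
    |S|^2/N, and only edges between [S] and its complement contribute to its Dirichlet form. *)
Lemma expander_cut (R : realType) (N d : nat) (e : rel 'I_N) (lam : R)
    (S : {set 'I_N}) :
  simple_graph e -> connected_graph e -> regular_graph e d -> (0 < d)%N ->
  (forall b, eigenvalue (laplacian R e d) b -> b != 0 -> lam <= b) ->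
  lam * (#|S|%:R - #|S|%:R ^+ 2 / N%:R)
    <= (\sum_(v in S) \sum_(w in ~: S) (e v w)%:R) / d%:R.
Proof.
move=> e_simple e_conn e_reg d_gt0 lamP.
have d_neq0 : d%:R != 0 :> R by rewrite pnatr_eq0 -lt0n.
case: (posnP N) => [N0|N_gt0].
  rewrite (_ : S = set0); last first.
    by apply/setP=> v; have := ltn_ord v; rewrite [X in (_ < X)%N]N0.
  by rewrite cards0 expr0n mul0r subrr mulr0 big_set0 mul0r.
have N_neq0 : N%:R != 0 :> R by rewrite pnatr_eq0 -lt0n.
(* Subtracting the density [p] makes [f] orthogonal to the constants, and the kernel of the Laplace
   operator consists of constants. *)
pose p : R := #|S|%:R / N%:R.
pose f : 'rV[R]_N := \row_v ((v \in S)%:R - p).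
have sumS : \sum_v (v \in S)%:R = #|S|%:R :> R.
  by rewrite -sum1_card natr_sum [RHS]big_mkcond; apply: eq_bigr => v _; case: (v \in S).
have sum_f : \sum_v f 0 v = 0.
  under eq_bigr do rewrite mxE; rewrite sumrB sumS sumr_const card_ord -mulr_natl /p.
  by field.
have norm_f : (f *m f^T) 0 0 = #|S|%:R - #|S|%:R ^+ 2 / N%:R.
  transitivity (\sum_v ((1 - 2 * p) * (v \in S)%:R + p ^+ 2)).
    rewrite mxE; apply: eq_bigr => v _; rewrite !mxE; case: (v \in S) => /=; ring.
  by rewrite big_split -mulr_sumr sumS sumr_const card_ord -mulr_natl /p /=; field.
have := symmetric_min_eigenvalue (f := f) _ lamP; rewrite norm_f.
rewrite dirichlet_form //.
suff -> : \sum_v \sum_w (e v w)%:R * (f 0 v - f 0 w) ^+ 2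
    = 2 * \sum_(v in S) \sum_(w in ~: S) (e v w)%:R.
  rewrite invfM mulrACA divff ?pnatr_eq0 // mul1r; apply.
    apply/matrixP=> v w; rewrite !mxE; case: e_simple => e_sym _.
    by rewrite e_sym eq_sym.
  move=> u /(laplacian_kernel e_simple e_conn e_reg d_gt0) u_const.
  apply/matrixP=> i j; rewrite !ord1 !mxE.
  rewrite (eq_bigr (fun v => u 0 (Ordinal N_gt0) * f 0 v)).
    by rewrite -mulr_sumr sum_f mulr0.
  by move=> v _; rewrite mxE (u_const v (Ordinal N_gt0)).
have cut_sum : \sum_(v in S) \sum_(w in ~: S) (e v w)%:R
   = \sum_v \sum_w (e v w)%:R * ((v \in S) && (w \notin S))%:R :> R.
  rewrite big_mkcond; apply: eq_bigr => v _; case: (v \in S) => /=; last first.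
    by rewrite big1 // => w _; rewrite mulr0.
  rewrite big_mkcond; apply: eq_bigr => w _; rewrite inE; case: (w \in S) => /=; ring.
have e_sym := e_simple.1.
transitivity (\sum_v \sum_w (e v w)%:R * ((v \in S) && (w \notin S))%:R
    + \sum_v \sum_w (e w v)%:R * ((w \in S) && (v \notin S))%:R : R).
  rewrite -big_split; apply: eq_bigr => v _; rewrite -big_split; apply: eq_bigr => w _ /=.
  by rewrite (e_sym w v) !mxE; case: (v \in S); case: (w \in S) => /=; ring.
by rewrite [X in _ + X]exchange_big cut_sum /=; ring.
Qed.

(** * Large components after the deletion of few vertices *)

Definition avoiding (T : finType) (Z : {set T}) (e : rel T) : rel T :=
  fun v w => [&& e v w, v \notin Z & w \notin Z].

(** Otherwise [expander_cut] gives each component C outside [Z] at least d lam |C| / 2 edges into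
    [Z]. At most d |Z| edges end in [Z], so summing over the components contradicts the bound on
    |Z|. *)
Lemma large_component (R : realType) (N d : nat) (e : rel 'I_N) (lam : R)
    (Z : {set 'I_N}) :
  simple_graph e -> connected_graph e -> regular_graph e d -> (0 < d)%N ->
  (forall b, eigenvalue (laplacian R e d) b -> b != 0 -> lam <= b) ->
  0 <= lam -> 2 * #|Z|%:R < lam * (N%:R - #|Z|%:R) ->
  exists2 r, r \notin Z & (N < 2 * #|[set w | connect (avoiding Z e) r w]|)%N.
Proof.
move=> e_simple e_conn e_reg d_gt0 lamP lam_ge0; rewrite ltNge => /negP Z_small.
have e_sym := e_simple.1.
set e' := avoiding Z e.
have e'_sym : connect_sym e'.
  apply: sym_connect_sym => v w.
  by rewrite /e' /avoiding e_sym; congr (_ && _); rewrite andbC.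
apply/exists_inP; apply: contra_notT Z_small => /exists_inPn small.
(* Components are indexed by all vertices through their canonical roots; [C j] is empty unless j is
   the root of a component outside [Z]. *)
pose C j := [set v | (v \notin Z) && (fingraph.root e' v == j)].
have C_small j : (2 * #|C j| <= N)%N.
  have [->|[v vC]] := set_0Vmem (C j); first by rewrite cards0.
  have /andP[vZ /eqP vj] : (v \notin Z) && (fingraph.root e' v == j) by rewrite inE in vC.
  have := small v vZ; rewrite -leqNgt; apply: leq_trans.
  rewrite leq_mul2l subset_leq_card //; apply/subsetP => w; rewrite !inE.
  by move=> /andP[_ /eqP]; rewrite -vj => /esym/(fingraph.rootP e'_sym).
have C_sum (F : 'I_N -> R) : \sum_j \sum_(v in C j) F v = \sum_(v in ~: Z) F v.
  rewrite [RHS](partition_big (fingraph.root e') xpredT) //=; apply: eq_bigr => j _.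
  by apply: eq_bigl => v; rewrite !inE.
have cut j : lam * (#|C j|%:R / 2) <= (\sum_(v in C j) \sum_(w in Z) (e v w)%:R) / d%:R.
  have := expander_cut (C j) e_simple e_conn e_reg d_gt0 lamP.
  (* An edge that leaves a component can only end in [Z]. *)
  have -> : \sum_(v in C j) \sum_(w in ~: C j) (e v w)%:R
      = \sum_(v in C j) \sum_(w in Z) (e v w)%:R :> R.
    apply: eq_bigr => v; rewrite inE => /andP[vZ /eqP vj].
    rewrite big_mkcond [RHS]big_mkcond; apply: eq_bigr => w _ /=; rewrite !inE.
    case: (boolP (w \in Z)) => //= wZ; case: eqP => //= wj.
    case: (boolP (e v w)) => // evw; case: wj.
    rewrite -vj; apply/esym/(fingraph.rootP e'_sym).
    by apply: connect1; rewrite /e' /avoiding evw vZ.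
  apply: le_trans; apply: ler_wpM2l => //.
  (* As |C| <= N/2, the quantity |C| - |C|^2/N is at least |C|/2. *)
  have := C_small j; rewrite -(ler_nat R) natrM.
  have : 0 <= #|C j|%:R :> R by [].
  move: #|C j|%:R => x x_ge0; case: (posnP N) => [->|N_gt0 xN].
    by rewrite invr0 mulr0 subr0; lra.
  have N_gt0' : 0 < N%:R :> R by rewrite ltr0n.
  suff : x ^+ 2 / N%:R <= x / 2 by lra.
  by rewrite ler_pdivrMr //; nra.
have edges_Z : \sum_(v in ~: Z) \sum_(w in Z) (e v w)%:R <= d%:R * #|Z|%:R :> R.
  rewrite exchange_big /= mulr_natr -sumr_const; apply: ler_sum => w _.
  rewrite -(sum_degree R w e_reg) big_mkcond; apply: ler_sum => v _ /=.
  by rewrite e_sym; case: ifP.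
have card_sum : \sum_j #|C j|%:R = N%:R - #|Z|%:R :> R.
  under eq_bigr do rewrite -sum1_card natr_sum; rewrite C_sum sumr_const.
  by rewrite cardsCs setCK card_ord natrB // -[X in (_ <= X)%N](card_ord N) max_card.
have : lam * ((N%:R - #|Z|%:R) / 2) <= #|Z|%:R.
  rewrite -card_sum mulr_suml mulr_sumr.
  apply: le_trans (_ : \sum_j (\sum_(v in C j) \sum_(w in Z) (e v w)%:R) / d%:R <= _).
    by apply: ler_sum => j _; apply: cut.
  by rewrite -mulr_suml C_sum ler_pdivrMr ?ltr0n // mulrC.
by lra.
Qed.

(** * Counting zeros of the oversampled exponential sum *)

(** Passing from the node y^2 to its square root y keeps the degree independent of m: the power (w
    y^2)^m left by a geometric sum collapses to w^m y. *)
Lemma exponential_sum_zeros (F : numClosedFieldType) (s m : nat)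
    (c w : 'I_s -> F) (Y : seq F) :
  (0 < s)%N -> (forall j, c j != 0) -> (forall j, w j != 0) -> injective w ->
  uniq Y ->
  (forall y, y \in Y -> y != 0 /\ y ^+ (2 * m) = y) ->
  (forall y, y \in Y ->
     \sum_(k < m) (\sum_(j < s) c j * w j ^+ k.+1) * (y ^+ 2) ^+ k.+1 = 0) ->
  (size Y < 2 * s)%N.
Proof.
move=> s_gt0 c_neq0 w_neq0 w_inj Y_uniq Y_root Y_zero.
pose Q j : {poly F} := \prod_(i in predC1 j) (1 - (w i)%:P * 'X^2).
pose T j : {poly F} := (c j * w j)%:P * (1 - (w j ^+ m)%:P * 'X) * Q j.
(* The geometric sums over k make p.[y] equal, up to the factors y^2 and
   1 - w_i y^2, to the given exponential sum at y^2, because y^(2m) = y. *)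
pose p := \sum_j T j.
have lin_size (a : F) k : (size (1 - a%:P * 'X^k : {poly F})%R <= k.+1)%N.
  apply: leq_trans (size_polyD _ _) _.
  rewrite size_poly1 size_polyN geq_max /=.
  apply: leq_trans (size_polyMleq _ _) _; rewrite size_polyXn.
  by have := size_polyC_leq1 a; lia.
have Q_size j : (size (Q j) <= 2 * s - 1)%N.
  apply: leq_trans (size_prod_leq _ _) _.
  have : (\sum_(i in predC1 j) size (1 - (w i)%:P * 'X^2 : {poly F})%R
            <= \sum_(i in predC1 j) 3)%N by exact: leq_sum.
  rewrite sum_nat_const cardC1 card_ord; lia.
have T_size j : (size (T j) <= 2 * s)%N.
  rewrite /T -mulrA mul_polyC; apply: leq_trans (size_scale_leq _ _) _.
  apply: leq_trans (size_polyMleq _ _) _.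
  by have := Q_size j; have := lin_size (w j ^+ m) 1; rewrite expr1; lia.
have p_size : (size p <= 2 * s)%N.
  by apply: leq_trans (size_sum _ _ _) _; apply/bigmax_leqP => j _.
have QE j y : (Q j).[y] = \prod_(i in predC1 j) (1 - w i * y ^+ 2).
  by rewrite horner_prod; apply: eq_bigr => i _; rewrite !hornerE.
have pE y : p.[y] = \sum_j c j * w j * (1 - w j ^+ m * y) * (Q j).[y].
  by rewrite horner_sum; apply: eq_bigr => j _; rewrite !hornerE.
have p_neq0 : p != 0.
  (* At x = +-w_j^(-1/2) only the summand j survives, and 1 - w_j^m x cannot
     vanish for both signs. *)
  pose j := Ordinal s_gt0; pose y := sqrtC (w j)^-1.
  have y2 : y ^+ 2 = (w j)^-1 by rewrite sqrtCK.
  have pjE x : x ^+ 2 = (w j)^-1 ->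
      p.[x] = c j * w j * (1 - w j ^+ m * x) * \prod_(i in predC1 j) (1 - w i / w j).
    move=> x2; rewrite pE (bigD1 j) //= QE x2 [X in _ + X]big1 ?addr0 // => i ij.
    rewrite QE (bigD1 j) /= ?inE 1?eq_sym // x2 divff // subrr mul0r mulr0 //.
  have : p.[y] + p.[- y] != 0.
    rewrite !pjE ?sqrrN //.
    rewrite (_ : _ + _ = 2 * (c j * w j * \prod_(i in predC1 j) (1 - w i / w j)));
      last by ring.
    rewrite !mulf_neq0 ?pnatr_eq0 //; apply/prodf_neq0 => i ij.
    rewrite subr_eq0; apply/eqP => /esym/(congr1 ( *%R^~ (w j))).
    by rewrite divfK // mul1r => /w_inj/eqP; rewrite (negPf ij).
  by apply: contraNneq => ->; rewrite !horner0 addr0.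
apply: leq_trans p_size; apply: max_poly_roots => //.
apply/allP => y yY; rewrite rootE pE.
have [y_neq0 ym] := Y_root y yY.
suff : y ^+ 2 * \sum_j c j * w j * (1 - w j ^+ m * y) * (Q j).[y] == 0.
  by rewrite mulf_eq0 expf_eq0 (negPf y_neq0).
have Y0 : \sum_j c j * \sum_(k < m) (w j * y ^+ 2) ^+ k.+1 = 0.
  rewrite -[RHS](Y_zero y yY); under [RHS]eq_bigr do rewrite mulr_suml.
  rewrite exchange_big; apply: eq_bigr => j _ /=.
  by rewrite mulr_sumr; apply: eq_bigr => k _; rewrite exprMn mulrA.
(* Multiplying by all factors 1 - w_i y^2, rather than dividing by them, also covers the case w_i
   y^2 = 1. *)
apply/eqP; rewrite -[RHS](mulr0 (\prod_i (1 - w i * y ^+ 2))) -[X in _ = _ * X]Y0.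
rewrite mulr_sumr [RHS]mulr_sumr; apply: eq_bigr => j _ /=.
have geom : (1 - w j * y ^+ 2) * \sum_(k < m) (w j * y ^+ 2) ^+ k.+1
    = w j * y ^+ 2 * (1 - w j ^+ m * y).
  transitivity (w j * y ^+ 2 * (1 - (w j * y ^+ 2) ^+ m)).
    under eq_bigr do rewrite exprS; rewrite -mulr_sumr.
    by rewrite -[1 - _ ^+ m]opprB subrX1; ring.
  by rewrite exprMn -exprM ym.
transitivity (c j * (w j * y ^+ 2 * (1 - w j ^+ m * y)) * (Q j).[y]); first by ring.
rewrite -geom QE [\prod_(i < s) _](bigD1 j) //=; ring.
Qed.

(** * The exponential e^(ix) and distinctness of the Prony nodes *)

Section Expi.
Variable R : realType.
Implicit Types x y : R.

Lemma expi0 : expi (0 : R) = 1.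
Proof. by rewrite /expi cos0 sin0. Qed.

Lemma expiD x y : expi (x + y) = expi x * expi y.
Proof. by rewrite /expi cosD sinD; simpc; congr (_ +i* _); ring. Qed.

Lemma expi_neq0 x : expi x != 0.
Proof.
apply: contra_neq (oner_neq0 R[i]) => x0.
by rewrite -expi0 -(subrr x) expiD x0 mul0r.
Qed.

Lemma expiMn x n : expi (x * n%:R) = expi x ^+ n.
Proof.
elim: n => [|n IHn]; first by rewrite mulr0 expi0.
by rewrite -natr1 mulrDr mulr1 expiD IHn exprSr.
Qed.

Lemma expi_2pi : expi (2 * pi : R) = 1.
Proof. by rewrite /expi mulr_natl cos2pi sin2pi. Qed.

(** From cos |x| = 1 the duplication formula gives sin(|x|/2) = 0, whereas the sine is positive
    between 0 and pi. *)
Lemma expi_eq1 x : `|x| < 2 * pi -> expi x = 1 -> x = 0.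
Proof.
move=> x_lt [cosx _]; apply/eqP; rewrite -normr_eq0; apply: contraT => x_neq0.
have : 0 < sin (`|x| / 2).
  have : 0 < `|x| by rewrite lt_def x_neq0 normr_ge0.
  by move=> x_gt0; apply: sin_gt0_pi; apply/andP; split; lra.
suff -> : sin (`|x| / 2) = 0 by rewrite ltxx.
have := cos_mulr2n (`|x| / 2).
rewrite -[`|x| / 2 *+ 2]mulr_natr divfK ?pnatr_eq0 // cos_norm cosx => cos_half.
by apply/eqP; rewrite -sqrf_eq0 sin2cos2; apply/eqP; lra.
Qed.

Lemma expi_inj x y : `|x - y| < 2 * pi -> expi x = expi y -> x = y.
Proof.
move=> xy_lt xy; apply/eqP; rewrite -subr_eq0; apply/eqP/expi_eq1 => //.
by rewrite expiD xy -expiD subrr expi0.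
Qed.

(** The arguments differ by at most 2 pi tau Lambda, which is less than one period. *)
Lemma nodes_inj (s : nat) (t : 'I_s -> R) (Lambda tau : R) :
  0 < tau -> tau * Lambda < 1 -> injective t ->
  (forall j, 0 <= t j <= Lambda) ->
  injective (fun j => expi (- (2 * pi * t j * tau))).
Proof.
move=> tau_gt0 tauL t_inj t_bd i j; have pi_gt0 := pi_gt0 R.
have [/andP[ti0 tiL] /andP[tj0 tjL]] := (t_bd i, t_bd j).
move/expi_inj => ij; apply: t_inj; apply/eqP; rewrite -subr_eq0.
have : - (2 * pi * t i * tau) = - (2 * pi * t j * tau).
  apply: ij; rewrite (_ : _ - _ = 2 * pi * (tau * (t j - t i))); last by ring.
  rewrite normrM gtr0_norm ?mulr_gt0 // gtr_pMr ?mulr_gt0 //.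
  rewrite normrM gtr0_norm //; apply: le_lt_trans tauL.
  rewrite ler_wpM2l ?(ltW tau_gt0) //.
  by rewrite ler_norml; apply/andP; split; lra.
move/eqP; rewrite eqr_opp -subr_eq0.
rewrite (_ : _ - _ = 2 * pi * tau * (t i - t j)); last by ring.
by rewrite !mulf_eq0 pnatr_eq0 (gt_eqF pi_gt0) (gt_eqF tau_gt0).
Qed.

Lemma fourierE (s : nat) (c : 'I_s -> R[i]) (t : 'I_s -> R) (tau : R) k :
  fourier c t (k%:R * tau) = \sum_j c j * expi (- (2 * pi * t j * tau)) ^+ k.
Proof.
by apply: eq_bigr => j _; rewrite -expiMn; congr (_ * expi _); ring.
Qed.

End Expi.

(** * Phase propagation along edges *)

Section Propagation.
Import ComplexField.Normc.

Lemma sqr_normcE (R : rcfType) (z : R[i]) :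
  (normc z ^+ 2)%:C = z * z^*.
Proof.
case: z => a b /=; rewrite sqr_sqrtr ?addr_ge0 ?sqr_ge0 //.
by simpc; congr (_ +i* _); ring.
Qed.

Lemma sqr_normc_eq0 (R : rcfType) (z : R[i]) : (normc z ^+ 2 == 0) = (z == 0).
Proof.
rewrite sqrf_eq0; apply/eqP/eqP => [/eq0_normc //|->]; exact: normc0.
Qed.

Variables (R : realType) (N : nat) (v : 'I_N -> R) (e : rel 'I_N) (g : R -> R[i]).
Let M := measure_graph v e g.

Lemma crossE (j k : 'I_N) : (j < k)%N -> e j k ->
  cross M j k = g (v j) * (g (v k))^*.
Proof.
move=> jk ejk; rewrite /cross /= jk ejk /=.
case: (g (v j)) (g (v k)) => a b [a' b'] /=; simpc.
by rewrite !sqr_sqrtr ?addr_ge0 ?sqr_ge0 //; congr (_ +i* _); field.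
Qed.

Lemma quotientE (u w : 'I_N) : simple_graph e -> e u w -> g (v u) != 0 ->
  quotient M u w = g (v w) / g (v u).
Proof.
move=> [e_sym e_irr] euw gu; rewrite /quotient /= sqr_normcE.
have gu' : (g (v u))^* != 0 by rewrite conjc_eq0.
have -> : (if (u < w)%N then (cross M u w)^* else cross M w u) = g (v w) * (g (v u))^*.
  case: ltngtP => [uw|wu|/val_inj uw].
  - by rewrite crossE // rmorphM /= conjcK mulrC.
  - by rewrite crossE // e_sym.
  - by rewrite uw e_irr in euw.
by field; rewrite gu.
Qed.

(** The quotients telescope along the successive assignments, so the factor chosen at the root is
    common to all assigned vertices. *)
Lemma propagatedE (r : 'I_N) (a : R[i]) (f : 'I_N -> option R[i]) (u : 'I_N) (z : R[i]) :
  simple_graph e -> propagated M e r a f -> f u = Some z ->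
  g (v u) != 0 /\ z = a / g (v r) * g (v u).
Proof.
move=> e_simple prop; elim: prop u z => [Mr _|f' u' w' z' _ IH fu _ euw Mw] u z.
  case: eqP => // -> [<-]; rewrite sqr_normc_eq0 in Mr; split=> //.
  by rewrite divfK.
case: eqP => [-> [<-]|_]; last exact: IH.
rewrite sqr_normc_eq0 in Mw; have [gu ->] := IH _ _ fu; split=> //.
by rewrite quotientE // -mulrA [g (v u') * _]mulrC divfK.
Qed.

Lemma propagated_root_scale (r : 'I_N) (a : R[i]) (f : 'I_N -> option R[i]) :
  propagated M e r a f -> g (v r) != 0 /\ `|a / g (v r)| = 1.
Proof.
elim=> // Mr Ma; rewrite sqr_normc_eq0 in Mr; split=> //.
have na : `|a| = `|g (v r)|.
  apply/eqP; rewrite -(eqrXn2 (n := 2)) //.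
  by rewrite !sqr_normc -!sqr_normcE Ma.
by rewrite normrM normfV na divff // normr_eq0.
Qed.

Lemma propagated_assigns_root (r : 'I_N) (a : R[i]) (f : 'I_N -> option R[i]) :
  propagated M e r a f -> f r.
Proof.
by elim=> [_ _|f' u w z _ IH _ _ _ _]; [rewrite eqxx | case: ifP].
Qed.

(** As long as the assignment is not exhausted it can be extended, and the number of unassigned
    vertices drops. *)
Lemma propagated_exhausted (r : 'I_N) (a : R[i]) :
  g (v r) != 0 -> normc a ^+ 2 = normc (g (v r)) ^+ 2 ->
  exists2 f, propagated M e r a f & exhausted M e f.
Proof.
move=> gr na.
have [f0 prop0] : exists f, propagated M e r a f.
  by eexists; apply: propagated_root => //; rewrite sqr_normc_eq0.
have [k] := ubnP #|[set u | ~~ f0 u]|.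
elim: k f0 prop0 => // k IH f prop fk.
have [/existsP[u /existsP[w /and4P[fu euw Mw fw]]]|] :=
    boolP [exists u, exists w, [&& isSome (f u), e u w, M0 M w != 0 & ~~ f w]].
  case fuE : (f u) fu => [z|] // _.
  have fwE : f w = None by case: (f w) fw.
  have prop' := propagated_step prop fuE fwE euw Mw.
  apply: (IH _ prop'); rewrite -ltnS; apply: leq_trans fk; rewrite ltnS.
  apply: proper_card.
  apply/properP; split; last by exists w; rewrite !inE ?eqxx ?fw.
  by apply/subsetP => x; rewrite !inE; case: eqP => // ->.
move=> /existsPn none; exists f => // u w fu euw Mw.
have /existsPn/(_ w) := none u; rewrite fu euw Mw /=.
by rewrite negbK.
Qed.

End Propagation.

(** * The sampling grid and its roots of unity *)

Section Grid.
Variables (R : realType) (n : nat).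
Hypothesis n_gt0 : (0 < n)%N.

Definition node (u : 'I_n.+1) : R[i] := expi (2 * pi / n%:R * u%:R).

Lemma node_exp (u : 'I_n.+1) : node u ^+ n = 1.
Proof.
have n_neq0 : n%:R != 0 :> R by rewrite pnatr_eq0 -lt0n.
rewrite /node -expiMn (_ : _ * _ = 2 * pi * u%:R); last by field.
by rewrite expiMn expi_2pi expr1n.
Qed.

(** The vertices 0 and n both carry the node 1, so the last one is left out; the remaining arguments
    lie within one period. *)
Lemma node_inj (u w : 'I_n.+1) : u != ord_max -> w != ord_max ->
  node u = node w -> u = w.
Proof.
move=> u_max w_max /expi_inj uw; have pi_gt0 := pi_gt0 R.
have n_gt0' : 0 < n%:R :> R by rewrite ltr0n.
have lt_n (x : 'I_n.+1) : x != ord_max -> (x%:R : R) < n%:R.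
  by move=> x_max; rewrite ltr_nat ltn_neqAle -ltnS ltn_ord andbT.
have [un wn] := (lt_n _ u_max, lt_n _ w_max).
have [u0 w0] : (0 <= u%:R :> R) /\ (0 <= w%:R :> R) by rewrite !ler0n.
have scale_gt0 : 0 < 2 * pi / n%:R :> R by rewrite divr_gt0 ?mulr_gt0.
apply/val_inj/eqP; rewrite -(eqr_nat R); apply/eqP.
apply: (mulfI (lt0r_neq0 scale_gt0)); apply: uw.
rewrite -mulrBr normrM gtr0_norm // mulrAC ltr_pdivrMr // ltr_pM2l ?mulr_gt0 //.
by rewrite ltr_norml; apply/andP; split; lra.
Qed.

Variables (Lambda : R) (v : 'I_n.+1 -> R).
Hypothesis Lambda_gt0 : 0 < Lambda.
Hypothesis vE : forall k, v k = 2 * Lambda / n%:R * k%:R.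

Lemma oversample_node (m : nat) (y : 'rV[R[i]]_m) (u : 'I_n.+1) :
  oversample Lambda y (v u) = \sum_(k < m) y 0 k * node u ^+ k.+1.
Proof.
have n_neq0 : n%:R != 0 :> R by rewrite pnatr_eq0 -lt0n.
apply: eq_bigr => k _; rewrite /node -expiMn vE; congr (_ * expi _).
by field; rewrite n_neq0 lt0r_neq0.
Qed.

(* Up to the factor [node u], an oversampled function is a polynomial of degree
   less than m in [node u]; only the two endpoints share their node. *)
Lemma oversample_inj (m : nat) (S : {set 'I_n.+1}) (y y' : 'rV[R[i]]_m) :
  (m < #|S|)%N ->
  (forall u, u \in S -> oversample Lambda y (v u) = oversample Lambda y' (v u)) ->
  y = y'.
Proof.
move=> mS yy'; pose p := rVpoly (y - y').
have sp : (size p <= m)%N by apply: size_poly.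
have pE x : p.[x] = \sum_(k < m) (y - y') 0 k * x ^+ k.
  rewrite (horner_coef_wide _ sp); apply: eq_bigr => k _.
  by rewrite coef_rVpoly_ord.
apply/eqP; rewrite -subr_eq0 -[y - y']rVpolyK -/p.
suff -> : p = 0 by rewrite linear0.
apply/eqP; apply: contraTT mS => p_neq0; rewrite -leqNgt.
have : (size [seq node u | u <- enum (S :\ ord_max)] < size p)%N.
  apply: max_poly_roots => //.
    apply/allP => x /mapP[u]; rewrite mem_enum => uS ->{x}; rewrite rootE pE.
    have u_neq0 : node u != 0 by exact: expi_neq0.
    rewrite -(mulrI_eq0 _ (mulfI u_neq0)) mulr_sumr.
    have /eqP := yy' u (subsetP (subsetDl _ _) _ uS).
    rewrite !oversample_node -subr_eq0 -sumrB; congr (_ == 0).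
    by apply: eq_bigr => k _; rewrite !mxE exprS; ring.
  rewrite map_inj_in_uniq ?enum_uniq // => u w; rewrite !mem_enum !inE.
  by move=> /andP[uM _] /andP[wM _]; apply: node_inj.
rewrite size_map -cardE => lt_p; have := leq_trans lt_p sp.
(* Leaving out the last vertex costs at most one element, which is why [S] needs more than m of
   them. *)
by rewrite (cardsD1 ord_max S); case: (_ \in S); rewrite ?add1n ?add0n // => /ltnW.
Qed.

Variables (m s : nat) (Omega : R) (c : 'I_s -> R[i]) (t : 'I_s -> R).

Lemma mutilde_node (u : 'I_n.+1) :
  mutilde Lambda Omega m c t (v u)
    = \sum_(k < m) (\sum_j c j * expi (- (2 * pi * t j * (Omega / m%:R))) ^+ k.+1)
        * node u ^+ k.+1.
Proof.
rewrite /mutilde oversample_node; apply: eq_bigr => k _.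
by rewrite mxE -mulrA fourierE.
Qed.

(** The m-th power of a node is a square root of it, because 2m = n + 1 and nodes are n-th roots of
    unity. Thus [exponential_sum_zeros] gives fewer than 2s zeros apart from the last vertex, which
    may add one. *)
Lemma mutilde_zeros :
  (2 * m = n.+1)%N -> (0 < s)%N -> (forall j, c j != 0) -> injective t ->
  0 < Omega -> Lambda * Omega < 1 / 2 -> (forall j, 0 <= t j <= Lambda) ->
  (#|[set u | mutilde Lambda Omega m c t (v u) == 0%R]| <= 2 * s)%N.
Proof.
move=> mn s_gt0 c_neq0 t_inj Omega_gt0 LO t_bd.
have m_gt0 : (0 < m)%N by lia.
have m_ge1 : 1 <= m%:R :> R by rewrite ler1n.
set Z := [set u | _].
have node2 u : (node u ^+ m) ^+ 2 = node u.
  by rewrite -exprM mulnC mn exprS node_exp mulr1.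
have : (size [seq node u ^+ m | u <- enum (Z :\ ord_max)] < 2 * s)%N.
  apply: (exponential_sum_zeros (m := m) (c := c)
    (w := fun j => expi (- (2 * pi * t j * (Omega / m%:R))))) => //.
  - by move=> j; apply: expi_neq0.
  - apply: (nodes_inj (Lambda := Lambda)) => //; first by rewrite divr_gt0 // ltr0n.
    by rewrite mulrAC ltr_pdivrMr ?ltr0n //; lra.
  - rewrite map_inj_in_uniq ?enum_uniq // => u w; rewrite !mem_enum !inE.
    move=> /andP[uM _] /andP[wM _] /(congr1 (fun x => x ^+ 2)).
    by rewrite !node2; apply: node_inj.
  - move=> _ /mapP[u _ ->]; split; first by rewrite expf_neq0 ?expi_neq0.
    by rewrite exprM node2.
  - move=> y /mapP[u]; rewrite mem_enum !inE => /andP[_ /eqP uZ] ->{y}.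
    by rewrite node2 -mutilde_node.
rewrite size_map -cardE => lt_s.
by rewrite (cardsD1 ord_max Z); case: (_ \in Z); rewrite ?add1n ?add0n // ltnW.
Qed.

End Grid.

(** * Prony's method *)

(** The equations say that the numbers c_j q(z_j) solve a homogeneous Vandermonde system. Hence q
    vanishes at all s nodes, and a monic polynomial of degree s is then determined. *)
Lemma prony_polynomial (F : fieldType) (s : nat) (c z : 'I_s -> F) :
  injective z -> (forall j, z j != 0) -> (forall j, c j != 0) ->
  unique (fun q : {poly F} =>
      [/\ q \is monic, size q = s.+1
        & forall k : nat, (1 <= k <= s.+1)%N ->
            \sum_(0 <= l < s.+1) q`_l * (\sum_j c j * z j ^+ (k + l)) = 0])
    (\prod_(j < s) ('X - (z j)%:P)).
Proof.
move=> z_inj z_neq0 c_neq0; set P := \prod_(j < s) _.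
have P_monic : P \is monic by apply: monic_prod_XsubC.
have P_size : size P = s.+1 by rewrite /P -big_enum size_prod_XsubC -cardE card_ord.
have recurrence (q : {poly F}) k : size q = s.+1 ->
    \sum_(0 <= l < s.+1) q`_l * (\sum_j c j * z j ^+ (k + l))
      = \sum_j (c j * q.[z j]) * z j ^+ k.
  move=> q_size; under eq_bigr do rewrite mulr_sumr.
  rewrite exchange_big; apply: eq_bigr => j _ /=.
  rewrite horner_coef q_size big_mkord mulr_sumr mulr_suml.
  by apply: eq_bigr => l _; rewrite exprD; ring.
split=> [|q [q_monic q_size q_rec]].
  split=> // k _; rewrite recurrence // big1 // => j _.
  by rewrite /P (bigD1 j) //= hornerM hornerXsubC subrr mul0r mulr0 mul0r.
have q_root j : root q (z j).
  have := @vandermonde_kernel _ _ z (fun j => c j * q.[z j]) z_inj z_neq0 _ j.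
  rewrite rootE => q0; apply/eqP; have /eqP : c j * q.[z j] = 0.
    by apply: q0 => k /andP[k1 ks]; rewrite -recurrence // q_rec // k1 ltnW.
  by rewrite mulf_eq0 (negPf (c_neq0 j)) /= => /eqP.
have : P %| q.
  rewrite /P -big_enum -(big_map z xpredT (fun a => 'X - a%:P)).
  apply: uniq_roots_dvdp; first by apply/allP => _ /mapP[j _ ->].
  by rewrite uniq_rootsE map_inj_uniq // enum_uniq.
move=> /dvdp_size_eqp; rewrite P_size q_size eqxx => /esym.
by rewrite eqp_monic // => /eqP.
Qed.

(** The difference of two solutions solves the homogeneous system, whose first s equations already
    force it to be 0. *)
Lemma vandermonde_unique (F : fieldType) (s n : nat) (c z : 'I_s -> F) (c0 : F) :
  (s <= n)%N -> injective z -> (forall j, z j != 0) ->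
  unique (fun b : 'rV[F]_s =>
      forall k : nat, (1 <= k <= n)%N ->
        \sum_(j < s) b 0 j * z j ^+ k = c0 * (\sum_j c j * z j ^+ k))
    (\row_(j < s) (c0 * c j)).
Proof.
move=> s_le z_inj z_neq0; split=> [k _|b bP].
  by rewrite mulr_sumr; apply: eq_bigr => j _; rewrite mxE mulrA.
apply/rowP => j; rewrite mxE; apply/eqP; rewrite eq_sym -subr_eq0; apply/eqP.
apply: (@vandermonde_kernel _ _ z (fun j => b 0 j - c0 * c j)) => // k /andP[k1 ks].
under eq_bigr do rewrite mulrBl -mulrA.
by rewrite sumrB -mulr_sumr bP ?subrr // k1 (leq_trans ks).
Qed.

(** * Numerical consequences of the bound on n *)

(** With x = sqrt(d - 1) > 1 the expression is (x - 1)^2. *)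
Lemma ramanujan_bound (R : realType) (d : nat) : (3 <= d)%N ->
  0 < d%:R - 2 * Num.sqrt (d%:R - 1) :> R.
Proof.
move=> d_ge3; have d3 : 3 <= d%:R :> R by rewrite ler_nat.
have := sqr_sqrtr (_ : 0 <= d%:R - 1 :> R).
have : 1 < Num.sqrt (d%:R - 1 : R) by rewrite -[ltLHS]sqrtr1 ltr_sqrt; lra.
move: (Num.sqrt _) => x x1 /(_ _) xd; have {}xd : x ^+ 2 = d%:R - 1 by apply: xd; lra.
suff : 0 < (x - 1) ^+ 2 by lra.
by rewrite exprn_even_gt0 //= subr_eq0 gt_eqF.
Qed.

Lemma bound_without_log (R : realType) (x sigma d delta n : R) :
  2 < sigma / x -> 0 < delta -> 0 <= d -> 0 <= sigma ->
  6 * d * (1 + 6 / ln (sigma / x)) * sigma / delta < n ->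
  6 * d * sigma < n * delta.
Proof.
move=> x2 delta_gt0 d_ge0 sigma_ge0; rewrite ltr_pdivrMr //; apply: le_lt_trans.
rewrite [leRHS]mulrAC ler_peMr ?mulr_ge0 //.
by rewrite lerDl divr_ge0 // ln_ge0 //; lra.
Qed.

Lemma odd_prime_half (n : nat) : prime n -> (2 < n)%N -> (2 * (n.+1 %/ 2) = n.+1)%N.
Proof.
move=> /even_prime[->|n_odd _] //.
by rewrite mulnC divnK // dvdn2 /= n_odd.
Qed.

(* The families [c] and [t] encode the measure \sum_j c_j \delta_{t_j}, supported
   exactly at the distinct points t_j.  [tau] is the sampling step of the second
   half; it ranges over 2 Omega/(n+1), that of the propagated values, and
   over the two other steps, 2 Omega/(n-1) and Omega/n, at which the equations
   for [q] and the nodes e^{-2 pi i t_j Omega/n} have been formulated. *)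
Theorem corollary3p20 (R : realType) (Lambda Omega : R)
    (hLambda : 0 < Lambda) (hOmega : 0 < Omega)
    (hLO : Lambda * Omega < 1 / 2)
    (s : nat) (hs : (0 < s)%N) (c : 'I_s -> R[i]) (t : 'I_s -> R)
    (hc : forall j, c j != 0) (ht : injective t)
    (htL : forall j, 0 <= t j <= Lambda)
    (d : nat) (hd : (3 <= d)%N) (n : nat) (hn : prime n)
    (hbound : 6 * d%:R * (1 + 6 / ln (s%:R / (Lambda * Omega))) * s%:R
                / (d%:R - 2 * Num.sqrt (d%:R - 1)) < n%:R)
    (v : 'I_n.+1 -> R) (hv : forall k, v k = 2 * Lambda / n%:R * k%:R)
    (e : rel 'I_n.+1) (he : ramanujan R e d) :
  let m := (n.+1 %/ 2)%N in
  let M := measure_graph v e (mutilde Lambda Omega m c t) in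
  [/\ exists x : 'rV[R[i]]_m, phase_propagation Lambda v e M x,
      forall x : 'rV[R[i]]_m, phase_propagation Lambda v e M x ->
        exists2 zeta : R[i], `|zeta| = 1
          & forall k : 'I_m,
              x 0 k = zeta * fourier c t (2 * k.+1%:R * Omega / (n%:R + 1))
    & forall tau : R,
        tau \in [:: 2 * Omega / (n%:R + 1); 2 * Omega / (n%:R - 1);
                    Omega / n%:R] ->
        let z := fun j : 'I_s => expi (- (2 * pi * t j * tau)) in
        unique (fun q : {poly R[i]} =>
            [/\ q \is monic, size q = s.+1
              & forall k : nat, (1 <= k <= s.+1)%N ->
                  \sum_(0 <= l < s.+1)
                     q`_l * fourier c t ((k + l)%:R * tau) = 0])
          (\prod_(j < s) ('X - (z j)%:P))
        /\ forall c0 : R[i], `|c0| = 1 ->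
             unique (fun b : 'rV[R[i]]_s =>
                 forall k : nat, (1 <= k <= n)%N ->
                   \sum_(j < s) b 0 j * z j ^+ k
                     = c0 * fourier c t (k%:R * tau))
               (\row_(j < s) (c0 * c j))].
Proof.
move=> m; set g := mutilde Lambda Omega m c t; move=> M.
have n_gt0 := prime_gt0 hn.
have d_gt0 : (0 < d)%N by apply: leq_trans hd.
have [e_simple e_conn e_reg [lam1 [_ _ lam1_min] lam1_ge]] := he.
have n_gt0' : 0 < n%:R :> R by rewrite ltr0n.
have d_gt0' : 0 < d%:R :> R by rewrite ltr0n.
have s_ge1 : 1 <= s%:R :> R by rewrite ler1n.
have LO_gt0 : 0 < Lambda * Omega by rewrite mulr_gt0.
set delta := d%:R - 2 * Num.sqrt (d%:R - 1) in hbound.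
have delta_gt0 : 0 < delta := ramanujan_bound R hd.
have n_large : 6 * d%:R * s%:R < n%:R * delta.
  apply: (bound_without_log _ delta_gt0 _ _ hbound) => //; rewrite ltr_pdivlMr //; lra.
(* This is the Ramanujan bound 1 - 2 sqrt(d - 1)/d for the smallest nonzero eigenvalue. *)
pose kappa := delta / d%:R.
have kappa_gt0 : 0 < kappa by rewrite divr_gt0.
have kappa_le1 : kappa <= 1.
  rewrite ler_pdivrMr // mul1r /delta; have := sqrtr_ge0 (d%:R - 1 : R); lra.
have kappa_min b : eigenvalue (laplacian R e d) b -> b != 0 -> kappa <= b.
  move=> eig_b b_neq0; apply: le_trans (lam1_min b eig_b b_neq0).
  by apply: le_trans lam1_ge; rewrite /kappa /delta mulrBl divff ?lt0r_neq0.
have n_kappa : 6 * s%:R < n%:R * kappa.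
  by rewrite /kappa mulrA ltr_pdivlMr // mulrAC.
have n_s : (6 * s < n)%N.
  rewrite -(ltr_nat R) natrM; apply: lt_le_trans n_kappa _.
  by rewrite ler_piMr // ltW.
have nm : (2 * m = n.+1)%N.
  apply: odd_prime_half hn _; apply: leq_ltn_trans n_s.
  by apply: leq_trans (leq_pmulr 6 hs).
have m_gt0 : (0 < m)%N by rewrite -(ltn_pmul2l (m := 2)) // nm.
have m2 : m%:R * 2 = n%:R + 1 :> R by rewrite natr1 -nm natrM mulrC.
have m_neq0 : m%:R != 0 :> R by rewrite pnatr_eq0 -lt0n.

split.
- pose Z := [set u | g (v u) == 0].
  have Z_small : (#|Z| <= 2 * s)%N by apply: mutilde_zeros.
  have [||r rZ comp] := large_component (Z := Z) e_simple e_conn e_reg d_gt0 kappa_min.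
  + exact: ltW.
  (* The constant 6 enters here: (2 + kappa) |Z| <= 3 |Z| <= 6 s < n kappa. *)
  + have : #|Z|%:R <= 2 * s%:R :> R by rewrite -natrM ler_nat.
    have : kappa * #|Z|%:R <= #|Z|%:R by rewrite ler_piMl.
    by rewrite -[n.+1%:R]natr1 mulrBr mulrDr mulr1 [kappa * n%:R]mulrC; lra.
  have gr : g (v r) != 0 by rewrite inE in rZ.
  (* Started from the true value at [r], the propagation reproduces [g], so the true samples of the
     Fourier transform are an output. *)
  have [f prop exh] := propagated_exhausted (v := v) e gr erefl.
  exists (\row_(k < m) fourier c t (k.+1%:R * Omega / m%:R)), r, (g (v r)), f.
  split=> // [y y' yy'|u z fu]; last first.
    have [_ ->] := propagatedE e_simple prop fu.
    by rewrite divff // mul1r.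
  apply: (oversample_inj n_gt0 hLambda hv (S := [set u | isSome (f u)])); last first.
    by move=> u; rewrite inE => /yy'.
  rewrite -(ltn_pmul2l (m := 2)) // nm; apply: leq_trans comp _.
  rewrite leq_mul2l /=; apply: subset_leq_card; apply/subsetP => w; rewrite !inE => /connectP[p].
  (* By induction along a path from [r] avoiding [Z], exhaustion forces every vertex of the
     component to be assigned. *)
  have := propagated_assigns_root prop.
  elim: p r {rZ gr prop} => [|u p IH] r fr /=; first by move=> _ ->.
  move=> /andP[/and3P[eru _ uZ] pth] wE; apply: (IH u _ pth wE).
  by apply: exh fr eru _; rewrite sqr_normc_eq0; rewrite inE in uZ.
- move=> x [r [a [f [prop exh inj xf]]]].
  have [_ zeta1] := propagated_root_scale prop.
  exists (a / g (v r)) => // k.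
  (* The true samples times the phase at the root have the same oversampled values as [x] on the
     assigned vertices, so injectivity identifies them. *)
  have -> : x = \row_k (a / g (v r) * fourier c t (k.+1%:R * Omega / m%:R)).
    apply: inj => u fu; case fuE : (f u) fu => [z|] // _.
    rewrite (xf _ _ fuE); have [_ ->] := propagatedE e_simple prop fuE.
    rewrite /g /mutilde /oversample mulr_sumr; apply: eq_bigr => l _.
    by rewrite !mxE mulrA.
  rewrite mxE -m2; congr (_ * fourier _ _ _).
  by field.
- move=> tau tauE z.
  have n2 : 2 <= n%:R - 1 :> R.
    rewrite lerBrDr -(natrD _ 2 1) ler_nat; apply: leq_ltn_trans n_s.
    by apply: leq_trans (leq_pmulr 6 hs).
  (* As n - 1 >= 2, all three steps are at most Omega, so tau Lambda < 1/2 and the nodes are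
     distinct. *)
  have [tau_gt0 tau_le] : 0 < tau /\ tau <= Omega.
    move: tauE; rewrite !inE => /or3P[] /eqP->.
    + by split; rewrite ?divr_gt0 ?ler_pdivrMr //; nra.
    + by split; rewrite ?divr_gt0 ?ler_pdivrMr //; nra.
    + by split; rewrite ?divr_gt0 ?ler_pdivrMr //; nra.
  have tauL : tau * Lambda < 1 by nra.
  have z_inj : injective z := nodes_inj tau_gt0 tauL ht htL.
  have z_neq0 j : z j != 0 by apply: expi_neq0.
  split=> [|c0 _].
    have [[q1 q2 q3] q_uniq] := prony_polynomial z_inj z_neq0 hc.
    split; first by split=> // k hk; under eq_bigr do rewrite fourierE; exact: q3.
    move=> q [h1 h2 h3]; apply: q_uniq; split=> // k hk; rewrite -[RHS](h3 k hk).
    by apply: eq_bigr => l _; rewrite fourierE.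
  have s_le_n : (s <= n)%N by apply: leq_trans (ltnW n_s); apply: leq_pmull.
  have [b1 b_uniq] := vandermonde_unique c c0 s_le_n z_inj z_neq0.
  split=> [k hk|b bP]; first by rewrite fourierE; exact: b1.
  by apply: b_uniq => k hk; rewrite bP // fourierE.
Qed.
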